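(* Let $\mathcal{M}$ be a class of irreducible, aperiodic, reversible Markov chains on finite state spaces, each chain $M\in\mathcal{M}$ having a problem size denoted by $n$, and let $\mathrm{poly}_1,\mathrm{poly}_2$ be polynomials. Suppose that for each $M\in\mathcal M$ the state space $Y$ is partitioned into disjoint nonempty classes $Y=\bigcup_{x\in X}Y_x$ indexed by the elements of some set $X$; an element $y\in Y_x$ is also written as the pair $(x,y)$. Let $T$ be the transition matrix of $M$, where $T(b|a)$ is the probability of moving from $a$ to $b$, and let $\pi$ be its stationary distribution. Let $\pi_X(x)=\pi(Y_x)$ for $x\in X$, and let $\pi_{Y_x}(y)=\pi(y)/\pi(Y_x)$ for $y\in Y_x$. Assume that for every $M\in\mathcal M$ the following hold. (i) For every $x\in X$, let $M_x$ be the Markov chain on $Y_x$ which has the same transition probabilities as $M$ for all transitions between distinct elements of $Y_x$, and whose loop probabilities are increased so that the transition probabilities out of each state sum to $1$ (transitions that would change $x$ have probability $0$). Then $M_x$ is aperiodic, irreducible and reversible with stationary distribution $\pi_{Y_x}$, and its second largest eigenvalue $\lambda_{M_x,2}$ satisfies $$\frac{1}{1-\lambda_{M_x,2}}\le \mathrm{poly}_1(n).$$ (ii) There exists a Markov chain $M'$ with state space $X$ and transition matrix $T'$ which is aperiodic, irreducible and reversible with respect to $\pi_X$, such that for all $x_1\ne x_2$ in $X$ and all $y_1\in Y_{x_1}$ $$\sum_{y_2\in Y_{x_2}}T\big((x_2,y_2)\,|\,(x_1,y_1)\big)\ \ge\ T'(x_2|x_1),$$ and the second largest eigenvalue $\lambda_{M',2}$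 of $M'$ satisfies $$\frac{1}{1-\lambda_{M',2}}\le \mathrm{poly}_2(n).$$ Then every $M\in\mathcal M$ is also rapidly mixing, as its second largest eigenvalue $\lambda_{M,2}$ obeys $$\frac{1}{1-\lambda_{M,2}}\le\frac{256\,\mathrm{poly}_1^2(n)\,\mathrm{poly}_2^2(n)}{\left(1-\frac{1}{\sqrt2}\right)^4}.$$
   Context: Eigenvalues of a reversible transition matrix are real and are listed with multiplicity in decreasing order $1=\lambda_1\ge\lambda_2\ge\cdots$; the second largest eigenvalue is $\lambda_2$. For a chain with a single state, the convention $\lambda_2=0$ is used. For a subset $S$ of the state space, $\pi(S)=\sum_{a\in S}\pi(a)$. *)

(* Defs.v *)
From mathcomp Require Import all_boot all_order all_algebra.
From mathcomp Require Import polyrcf reals.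

Set Implicit Arguments.
Unset Strict Implicit.
Unset Printing Implicit Defensive.

Import Order.TTheory GRing.Theory Num.Theory.
Local Open Scope ring_scope.

(* [trans M a b] is T(b | a), the probability of moving from [a] to [b]. *)
Record markov_chain (R : realType) (Y : finType) := MarkovChain {
  trans :> Y -> Y -> R;
  trans_ge0 : forall a b, 0 <= trans a b;
  trans_sum1 : forall a, \sum_b trans a b = 1
}.

Section MarkovChains.
Variables (R : realType) (Y : finType).
Implicit Types (M : markov_chain R Y) (mu : Y -> R).

Definition trans_mx M : 'M[R]_#|Y| :=
  \matrix_(i, j) M (enum_val i) (enum_val j).

Definition ntrans M (k : nat) (a b : Y) : R :=
  (trans_mx M ^+ k) (enum_rank a) (enum_rank b).

Definition irreducible M : Prop := forall a b, exists k, 0 < ntrans M k a b.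

(* The gcd of the return times [k >= 1] of every state is 1. *)
Definition aperiodic M : Prop :=
  forall (a : Y) (d : nat),
    (forall k, (0 < k)%N -> 0 < ntrans M k a a -> (d %| k)%N) -> d = 1%N.

Definition distribution mu : Prop :=
  (forall a, 0 <= mu a) /\ \sum_a mu a = 1.

Definition stationary M mu : Prop :=
  distribution mu /\ forall b, \sum_a mu a * M a b = mu b.

Definition reversible M mu : Prop :=
  stationary M mu /\ forall a b, mu a * M a b = mu b * M b a.

End MarkovChains.

(* The real eigenvalues, repeated according to their multiplicity as roots of
   the characteristic polynomial, in decreasing order.  For the transition
   matrix of a reversible irreducible chain these are all the eigenvalues. *)
Definition eigenvalues (R : realType) (n : nat) (A : 'M[R]_n) : seq R :=
  sort (fun a b => b <= a)
    (flatten [seq nseq (mup a (char_poly A)) a | a <- rootsR (char_poly A)]).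

(* The eigenvalue list of a single-state chain is [:: 1], so the default value
   of [nth] implements the convention lambda_2 = 0 for such a chain. *)
Definition lambda2 (R : realType) (Y : finType) (M : markov_chain R Y) : R :=
  nth 0 (eigenvalues (trans_mx M)) 1.

Definition is_partition (X Y : finType) (Yc : X -> {set Y}) : Prop :=
  [/\ forall x, Yc x != set0,
      forall x1 x2, x1 != x2 -> [disjoint Yc x1 & Yc x2] &
      \bigcup_x Yc x = [set: Y]].

Section Restriction.
Variables (R : realType) (Y : finType) (M : markov_chain R Y) (S : {set Y}).

Definition restr_trans (a b : {y : Y | y \in S}) : R :=
  if a == b then 1 - \sum_(c | c != a) M (val a) (val c)
  else M (val a) (val b).

Lemma restr_trans_ge0 a b : 0 <= restr_trans a b.
Proof.
rewrite /restr_trans; case: eqP => _; last exact: trans_ge0.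
rewrite subr_ge0 -(trans_sum1 M (val a)).
rewrite -(big_imset (M (val a))) /=; last by move=> u v _ _; apply: val_inj.
rewrite [leRHS](bigID [in [set val c | c in predC1 a]]) /=.
by rewrite lerDl sumr_ge0 // => c _; apply: trans_ge0.
Qed.

Lemma restr_trans_sum1 a : \sum_b restr_trans a b = 1.
Proof.
rewrite (bigD1 a) //= {1}/restr_trans eqxx.
rewrite [X in _ + X](eq_bigr (fun c => M (val a) (val c))) ?subrK //.
by move=> c /negPf nca; rewrite /restr_trans eq_sym nca.
Qed.

Definition restr_chain : markov_chain R {y : Y | y \in S} :=
  MarkovChain restr_trans_ge0 restr_trans_sum1.

Definition mass (mu : Y -> R) : R := \sum_(y in S) mu y.

Definition cond_distr (mu : Y -> R) (y : {y : Y | y \in S}) : R :=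
  mu (val y) / mass mu.

End Restriction.
Arguments mass {R Y} S mu.
Arguments cond_distr {R Y} S mu y.

(* Main.v *)
Require Import Defs.
From mathcomp Require Import all_boot all_order all_algebra.
From mathcomp Require Import polyrcf reals complex ring lra.

(* For a reversible chain, [1 / (1 - lambda2)] is the best constant K in the
   Poincare inequality Var f <= K * E(f), where E is the Dirichlet form.
   By the law of total variance, Var f is the sum of the variances within the
   classes and of the variance of the class means.  The first part is at most
   poly1 times the energy inside the classes.  The second is at most poly2
   times the energy of the class means under M', and joining two class means
   through the endpoints of an edge of M bounds that energy by 3 times the
   within-class variance plus the energy of M between classes.  Altogether
   K <= p1 + 3 p1 p2 + 3 p2, and p1, p2 >= 1/2 because all eigenvalues are
   at least -1, so K <= 64 p1^2 p2^2. *)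

Set Implicit Arguments.
Unset Strict Implicit.
Unset Printing Implicit Defensive.

Import Order.TTheory GRing.Theory Num.Theory.
Local Open Scope ring_scope.

(** * Spectrum of a reversible matrix *)

(** The multiplicity of a root of a split polynomial is its count in [s], so regrouping [s] by
    distinct values gives the list. This lets [lambda2] be read off a diagonalization. *)
Lemma perm_eigenvalues (R : realType) n (A : 'M[R]_n) (s : seq R) :
  char_poly A = \prod_(a <- s) ('X - a%:P) -> perm_eq (eigenvalues A) s.
Proof.
move=> As; rewrite /eigenvalues perm_sort; apply: perm_trans (perm_count_undup s).
rewrite As (eq_map (fun a => congr1 (nseq^~ a) (mu_prod_XsubC a s))).
apply/perm_flatten/perm_map/uniq_perm; rewrite ?undup_uniq ?uniq_roots //.
move=> a; rewrite mem_undup -roots_on_rootsR; last first.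
  by rewrite monic_neq0 // monic_prod_XsubC.
by rewrite itv_boundlr /= root_prod_XsubC.
Qed.

Lemma mem_eigenvalues (R : realType) n (A : 'M[R]_n) a :
  a \in eigenvalues A -> eigenvalue A a.
Proof.
rewrite mem_sort => /flattenP [_ /mapP [b bA ->]] /nseqP [-> _].
rewrite eigenvalue_root_char.
have := roots_on_rootsR (monic_neq0 (char_poly_monic A)) b.
by rewrite bA => /andP[].
Qed.

(** Counts are invariant under permutation, so this lemma and the next locate the second largest
    entry from an unsorted list. Two entries at least [x] also rule out the default value of
    [nth]. *)
Lemma ge_nth1_sorted (R : realDomainType) (s : seq R) x :
  sorted >=%R s -> (1 < count (>= x) s)%N -> x <= nth 0 s 1.
Proof.
case: s => [|a [|b s]] //=; first by case: (x <= a).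
move=> /andP[_ bs]; apply: contraTT; rewrite -ltNge => bx.
have -> : (x <= b) = false by rewrite leNgt bx.
suff /eqP -> : count (>= x) s == 0%N by rewrite !addn0 -leqNgt leq_b1.
rewrite -leqn0 leqNgt -has_count -all_predC.
have ge_trans : transitive (>=%R : rel R) by move=> u v w /[swap]; apply: le_trans.
apply/allP => c /(allP (order_path_min ge_trans bs)) /= cb.
by rewrite -ltNge (le_lt_trans cb).
Qed.

(** The size bound excludes the default value [0], which need not be below [x]. *)
Lemma gt_nth1_sorted (R : realDomainType) (s : seq R) x :
  sorted >=%R s -> (1 < size s)%N -> (count (>= x) s <= 1)%N -> nth 0 s 1 < x.
Proof.
case: s => [|a [|b s]] //= /andP[ba _] _; apply: contraTT; rewrite -leNgt -ltnNge => xb.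
by rewrite xb (le_trans xb ba).
Qed.

Lemma char_poly_similar (R : comUnitRingType) n (A B Q : 'M[R]_n) :
  Q \in unitmx -> A = invmx Q *m B *m Q -> char_poly A = char_poly B.
Proof.
move=> Qu ->; rewrite /char_poly /char_poly_mx !map_mxM /=.
set q := map_mx _ Q; set q' := map_mx _ (invmx Q); set b := map_mx _ B.
have q'q : q' *m q = 1%:M by rewrite -map_mxM mulVmx // map_mx1.
have -> : 'X%:M - q' *m b *m q = q' *m ('X%:M - b) *m q.
  rewrite mulmxBr mulmxBl; congr (_ - _).
  by rewrite -mulmxA -scalar_mxC mulmxA q'q mul1mx.
by rewrite !det_mulmx mulrAC -det_mulmx q'q det1 mul1r.
Qed.

Lemma char_poly_trmx (R : comNzRingType) n (A : 'M[R]_n) :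
  char_poly A^T = char_poly A.
Proof.
rewrite /char_poly -[RHS]det_tr; congr (\det _).
by rewrite /char_poly_mx linearB /= tr_scalar_mx map_trmx.
Qed.

Lemma count_codom (I : finType) (S : Type) (p : pred S) (d : I -> S) :
  count p (codom d) = #|[pred i | p (d i)]|.
Proof. by rewrite count_map cardE -size_filter enumT. Qed.

(** * Spectral theorem and Rayleigh bound for reversible matrices *)

Section Diagonalization.
Local Open Scope complex_scope.
Local Open Scope sesquilinear_scope.

(** With [D] the diagonal matrix of the square roots of [w], reversibility says that [D T D^-1] is
    symmetric. The spectral theorem over [R[i]] gives a unitary [P], and [Q = P D]. The last clause
    makes [Q] an isometry from the [w]-weighted inner product to the standard one. *)
Lemma reversible_diagonalization (R : rcfType) n (T : 'M[R]_n) (w : 'I_n -> R) :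
    (forall i, 0 < w i) -> (forall i j, w i * T i j = w j * T j i) ->
  exists (Q : 'M[R[i]]_n) (d : 'I_n -> R),
    [/\ Q \in unitmx,
        map_mx (real_complex R) T
          = invmx Q *m diag_mx (\row_i (d i)%:C) *m Q &
        Q^t* *m Q = diag_mx (\row_i (w i)%:C)].
Proof.
move=> w_gt0 wT; pose r i := Num.sqrt (w i).
have r_neq0 i : r i != 0 by rewrite gt_eqF ?sqrtr_gt0.
have rr i : r i * r i = w i by rewrite -expr2 sqr_sqrtr ?ltW.
pose S : 'M[R[i]]_n := \matrix_(i, j) (r i * T i j / r j)%:C.
pose D : 'M[R[i]]_n := diag_mx (\row_i (r i)%:C).
have realC (x : R) : x%:C \is Num.real by rewrite complex_real.
have Sherm : S \is hermsymmx.
  apply: realsym_hermsym; last by apply/mxOverP => i j; rewrite mxE.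
  apply/is_hermitianmxP; rewrite expr0 scale1r; apply/matrixP => i j.
  rewrite !mxE; congr (_%:C); apply: (mulfI (r_neq0 i)); apply: (mulIf (r_neq0 j)).
  transitivity (r i * r i * T i j); first by field.
  by rewrite rr wT -rr; field.
pose P := spectralmx S; have Puni : P \is unitarymx by exact: spectral_unitarymx.
have Pu := spectral_unit S.
have DS : S *m D = D *m map_mx (real_complex R) T.
  rewrite mul_mx_diag mul_diag_mx; apply/matrixP => i j; rewrite !mxE.
  by rewrite -!rmorphM divfK.
have Du : D \in unitmx.
  rewrite unitmxE unitfE det_diag; apply/prodf_neq0 => i _.
  by rewrite mxE fmorph_eq0.
have Qu : P *m D \in unitmx by rewrite unitmx_mul Pu.
exists (P *m D), (fun i => complex.Re (spectral_diag S 0 i)); split=> //.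
(* A Hermitian matrix has a real spectrum, so taking real parts loses nothing. *)
- have -> : \row_i (complex.Re (spectral_diag S 0 i))%:C = spectral_diag S.
    apply/rowP => i; rewrite !mxE RRe_real //.
    by have /mxOverP := hermitian_spectral_diag_real Sherm.
  have /orthomx_spectralP SE := hermitian_normalmx Sherm.
  apply: (can_inj (mulKmx Qu)); rewrite -[in RHS]mulmxA (mulKVmx Qu).
  by rewrite -mulmxA -DS {1}SE !mulmxA mulmxV // mul1mx.
- rewrite trmx_mul map_mxM /= mulmxA -(mulmxA _ _ P) -(invmx_unitary Puni) mulVmx // mulmx1.
  rewrite tr_diag_mx mul_mx_diag; apply/matrixP => i j; rewrite !mxE.
  case: eqP => [->|_]; rewrite ?mulr1n ?mulr0n; last by rewrite conjC0 mul0r.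
  by rewrite conj_Creal // -rmorphM rr.
Qed.

(** By [harmonic] the eigenvalue 1 is simple, with the constants as eigenvectors. A [w]-centred
    vector is orthogonal to them, so only eigenvalues up to the second one enter its Rayleigh
    quotient. *)
Lemma second_eigenvalue_rayleigh (R : realType) n (T : 'M[R]_n) (w : 'I_n -> R)
    (l := nth 0 (eigenvalues T) 1) :
    (forall i, 0 < w i) -> (forall i j, w i * T i j = w j * T j i) ->
    T *m const_mx 1 = const_mx 1 :> 'cV_n ->
    (forall a, eigenvalue T a -> a <= 1) ->
    (forall h : 'cV[R]_n, T *m h = h -> forall i j, h i 0 = h j 0) ->
  l < 1 /\
  forall v : 'cV[R]_n, \sum_i w i * v i 0 = 0 ->
    \sum_i w i * v i 0 * (T *m v) i 0 <= l * \sum_i w i * v i 0 ^+ 2.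
Proof.
move=> w_gt0 wT T1 T_le1 harmonic.
have [Q [d [Qu TE QQ]]] := reversible_diagonalization w_gt0 wT.
set L := diag_mx _ in TE.
have QT : Q *m map_mx (real_complex R) T = L *m Q.
  by rewrite TE !mulmxA mulmxV // mul1mx.
have charE : char_poly T = \prod_(a <- codom d) ('X - a%:P).
  apply: (map_poly_inj (real_complex R)).
  rewrite map_char_poly (char_poly_similar Qu TE) char_poly_trig ?diag_mx_is_trig //.
  rewrite rmorph_prod /= big_map big_enum /=; apply: eq_bigr => i _.
  by rewrite rmorphB /= map_polyX map_polyC /= !mxE eqxx mulr1n.
have eigE := perm_eigenvalues charE.
have sortedE : sorted >=%R (eigenvalues T).
  by apply: sort_sorted => a b; apply: le_total.
have d_le1 i : d i <= 1.
  by apply/T_le1/mem_eigenvalues; rewrite (perm_mem eigE) codom_f.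
(* Columns of [invmx Q] for the eigenvalue 1 are constant, and two constant columns contradict
   [Q *m invmx Q = 1]. *)
have d_simple i j : d i = 1 -> d j = 1 -> i = j.
  have col_const k : d k = 1 -> forall a b, invmx Q a k = invmx Q b k.
    move=> dk a b; pose h := col k (invmx Q).
    have Th : map_mx (real_complex R) T *m h = h.
      rewrite /h colE mulmxA TE mulmxK // -mulmxA; congr (_ *m _).
      by rewrite mul_diag_mx; apply/colP => i'; rewrite !mxE;
         case: eqP => [->|_]; rewrite ?dk ?mul1r ?mulr0.
    suff hab : h a 0 = h b 0 by move: hab; rewrite !mxE.
    move: h Th => h Th.
    have {}Th z : h z 0 = \sum_y (T z y)%:C * h y 0.
      by rewrite -[in LHS]Th mxE; apply: eq_bigr => y _; rewrite mxE.
    (* [harmonic] concerns real vectors; [f] stands for the real or the imaginary part. *)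
    have proj_harmonic (f : R[i] -> R) :
        {morph f : x y / x + y} -> (forall x y, f (x%:C * y) = x * f y) ->
      f (h a 0) = f (h b 0).
      move=> fD fM; have f0 : f 0 = 0 by rewrite -(mul0r 0) (fM 0) mul0r.
      have := harmonic (\col_z f (h z 0)) _ a b; rewrite !mxE; apply.
      apply/colP => z; rewrite !mxE [in RHS]Th (big_morph f fD f0).
      by apply: eq_bigr => y _; rewrite !mxE fM.
    apply/eqP; rewrite eq_complex !proj_harmonic ?eqxx //.
    - by case=> [??] [].
    - by move=> x [p q]; rewrite /= mul0r addr0.
    - by case=> [??] [].
    - by move=> x [p q]; rewrite /= mul0r subr0.
  move=> /col_const Ci /col_const Cj; apply/eqP; apply: contraT => ij.
  have QV a b c : (forall x y, invmx Q x c = invmx Q y c) ->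
      (\sum_k Q a k) * invmx Q b c = (a == c)%:R.
    move=> Cc; have /matrixP/(_ a c) := mulmxV Qu; rewrite !mxE => <-.
    by rewrite mulr_suml; apply: eq_bigr => k _; congr (_ * _).
  have := QV i i j Cj; rewrite (negPf ij) => /eqP; rewrite mulf_eq0 => /orP[]/eqP r0.
    by have := QV i i i Ci; rewrite eqxx r0 mul0r => /esym/eqP; rewrite oner_eq0.
  by have := QV j i j Cj; rewrite eqxx r0 mulr0 => /esym/eqP; rewrite oner_eq0.
have count_ge x : (1 < count (>= x) (eigenvalues T))%N <->
    exists i j, [/\ i != j, x <= d i & x <= d j].
  rewrite (permP eigE) count_codom; split.
    by case/card_gt1P => i [j [xi xj ij]]; exists i, j.
  by case=> i [j [ij xi xj]]; apply/card_gt1P; exists i, j.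
split.
  have [le1|gt1] := leqP (size (eigenvalues T)) 1; first by rewrite /l nth_default.
  apply: gt_nth1_sorted => //; rewrite leqNgt; apply/negP => /count_ge.
  case=> i [j [/eqP ij di dj]]; apply: ij.
  by apply: d_simple; apply/eqP; rewrite eq_le ?di ?dj ?d_le1.
have gram (u v : 'cV[R]_n) :
    \sum_i Num.conj ((Q *m map_mx (real_complex R) u) i 0)
      * (Q *m map_mx (real_complex R) v) i 0 = (\sum_i w i * u i 0 * v i 0)%:C.
  set u' := map_mx _ u; set v' := map_mx _ v.
  transitivity (((Q *m u')^t* *m (Q *m v')) 0 0).
    by rewrite mxE; apply: eq_bigr => i _; rewrite !mxE.
  rewrite trmx_mul map_mxM mulmxA -(mulmxA (u'^t*)) QQ mul_mx_diag mxE rmorph_sum.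
  apply: eq_bigr => i _; rewrite !mxE conj_Creal ?complex_real //.
  by rewrite -!rmorphM [u i 0 * _]mulrC.
move=> v v_mean0.
pose c := Q *m map_mx (real_complex R) v.
pose e := Q *m map_mx (real_complex R) (const_mx 1 : 'cV_n).
have Le i : d i != 1 -> e i 0 = 0.
  have : L *m e = e by rewrite mulmxA -QT -mulmxA -map_mxM T1.
  rewrite mul_diag_mx => /colP/(_ i); rewrite mxE mxE => /eqP.
  rewrite -subr_eq0 -{2}[e i 0]mul1r -mulrBl mulf_eq0 => /orP[|/eqP //].
  by rewrite subr_eq0 => /eqP /complexI ->; rewrite eqxx.
have ce : \sum_i Num.conj (c i 0) * e i 0 = 0.
  rewrite gram (_ : \sum_i _ = 0) // -[RHS]v_mean0.
  by apply: eq_bigr => i _; rewrite mxE mulr1.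
(* The constants have a component only along the simple eigenvalue 1, so a
   centred vector has none along any eigenvalue above [l]. *)
have c0 i : l < d i -> c i 0 = 0.
  move=> ldi.
  have [k ek] : exists k, e k 0 != 0.
    apply/existsP; apply: contraT; rewrite negb_exists => /forallP /= e0.
    have /colP/(_ i)/eqP : map_mx (real_complex R) (const_mx 1 : 'cV_n) = 0.
      apply: (can_inj (mulKmx Qu)); rewrite mulmx0; apply/colP => j.
      by rewrite [RHS]mxE; apply/eqP; have := e0 j; rewrite negbK.
    by rewrite !mxE fmorph_eq0 oner_eq0.
  have dk : d k = 1 by apply/eqP; apply: contraNT ek => /Le ->.
  (* A second diagonal entry at least [d i] would force [d i <= l]. *)
  have top j : 1 <= d j -> j = i.
    move=> dj; apply/eqP; apply: contraT => ji.
    have := ldi; rewrite ltNge => /negP []; apply: ge_nth1_sorted => //.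
    by apply/count_ge; exists j, i; rewrite ji (le_trans (d_le1 i)).
  move: ce; rewrite (bigD1 i) //= big1 => [|j ji].
    rewrite addr0 -{2}(top k) ?dk // => /eqP; rewrite mulf_eq0 (negPf ek) orbF.
    by rewrite conjC_eq0 => /eqP.
  rewrite Le ?mulr0 //; apply: contra ji => /eqP dj.
  by rewrite (top j) ?dj.
rewrite -lecR rmorphM /=.
have -> : \sum_i w i * v i 0 ^+ 2 = \sum_i w i * v i 0 * v i 0.
  by apply: eq_bigr => i _; rewrite expr2 mulrA.
(* In the coordinates [c] both sides are sums of squared moduli, weighted by [d i] and by [l]; they
   are compared termwise. *)
rewrite -!gram map_mxM mulmxA QT -(mulmxA L) -/c mulr_sumr.
apply: ler_sum => i _; rewrite mul_diag_mx mxE [(\row_ _ _) _ _]mxE mulrCA -normCKC.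
have [dl|/c0 ->] := leP (d i) l; last by rewrite normr0 expr0n !mulr0.
by rewrite ler_wpM2r ?exprn_ge0 // lecR.
Qed.

End Diagonalization.

(** * Variance and Dirichlet form of a chain *)

Section ReversibleChain.
Variables (R : realType) (Y : finType).
Implicit Types (M : markov_chain R Y) (mu f : Y -> R).

Definition mean mu f : R := \sum_a mu a * f a.

Definition variance mu f : R := \sum_a mu a * (f a - mean mu f) ^+ 2.

Definition dirichlet M mu f : R :=
  2^-1 * \sum_a \sum_b mu a * M a b * (f a - f b) ^+ 2.

(** A positive [k]-step probability yields a path of positive transitions, along which [P]
    propagates. *)
Lemma irreducible_closed M (P : Y -> Prop) :
  irreducible M -> (forall a b, P a -> 0 < M a b -> P b) ->
  forall a b, P a -> P b.
Proof.
move=> irrM closedP a b Pa; have [k] := irrM a b.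
rewrite /ntrans; elim: k a Pa => [|k IHk] a Pa.
  rewrite expr0 mxE (inj_eq enum_rank_inj).
  by case: (a =P b) => [<- //|_]; rewrite mulr0n ltxx.
rewrite exprS mxE => sum_gt0.
have [c] : exists c, 0 < trans_mx M (enum_rank a) c * (trans_mx M ^+ k) c (enum_rank b).
  apply/existsP; apply: contraLR sum_gt0; rewrite negb_exists => /forallP nc.
  by rewrite -leNgt sumr_le0 // => c _; rewrite leNgt nc.
have pow_ge0 i j : 0 <= (trans_mx M ^+ k) i j.
  elim: k {IHk sum_gt0} i j => [|k IHk] i j; first by rewrite expr0 mxE; case: (_ == _).
  by rewrite exprS mxE sumr_ge0 // => c' _; rewrite mulr_ge0 ?mxE ?trans_ge0.
rewrite mxE enum_rankK => prod_gt0; have M_gt0 : 0 < M a (enum_val c).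
  by rewrite lt_def trans_ge0 andbT; apply: contraTneq prod_gt0 => ->; rewrite mul0r ltxx.
rewrite pmulr_rgt0 // in prod_gt0.
by apply: (IHk (enum_val c)); rewrite ?enum_valK //; apply: closedP M_gt0.
Qed.

(** The support of [mu] is nonempty and closed under transitions. *)
Lemma stationary_gt0 M mu : irreducible M -> stationary M mu -> forall a, 0 < mu a.
Proof.
move=> irrM [[mu_ge0 mu1] muM] b.
have [a mua] : exists a, 0 < mu a.
  apply/existsP; apply: contraT; rewrite negb_exists => /forallP mu0.
  suff : \sum_a mu a <= 0 by rewrite mu1 ler10.
  by apply: sumr_le0 => a _; rewrite leNgt mu0.
apply: (irreducible_closed irrM (P := fun c => 0 < mu c)) mua => {a b} a b mua Mab.
rewrite -muM (bigD1 a) //= ltr_pwDl ?mulr_gt0 // sumr_ge0 // => c _.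
by rewrite mulr_ge0 ?trans_ge0.
Qed.

(** Expand the square: row sums and stationarity give both square terms the same total. The case
    [c = -1] is the Dirichlet form; [c = 1] and [c = -1] together bound the spectrum. *)
Lemma stationary_square M mu f (c : R) : stationary M mu ->
  2^-1 * \sum_a \sum_b mu a * M a b * (f a + c * f b) ^+ 2
  = 2^-1 * (1 + c ^+ 2) * \sum_a mu a * f a ^+ 2
    + c * \sum_a mu a * f a * \sum_b M a b * f b.
Proof.
case=> _ muM.
have out : \sum_a \sum_b mu a * M a b * f a ^+ 2 = \sum_a mu a * f a ^+ 2.
  apply: eq_bigr => a _; rewrite -mulr_suml -mulr_sumr trans_sum1 mulr1 //.
have inn : \sum_a \sum_b mu a * M a b * f b ^+ 2 = \sum_a mu a * f a ^+ 2.
  by rewrite exchange_big; apply: eq_bigr => b _; rewrite -mulr_suml muM.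
have cross : \sum_a mu a * f a * \sum_b M a b * f b
    = \sum_a \sum_b mu a * M a b * (f a * f b).
  by apply: eq_bigr => a _; rewrite mulr_sumr; apply: eq_bigr => b _; ring.
set S := \sum_a mu a * f a ^+ 2 in out inn *; rewrite cross.
have -> : 2^-1 * (1 + c ^+ 2) * S = 2^-1 * S + 2^-1 * c ^+ 2 * S by ring.
rewrite -{1}out -inn !mulr_sumr -!big_split; apply: eq_bigr => a _ /=.
rewrite !mulr_sumr -!big_split; apply: eq_bigr => b _ /=.
by field.
Qed.

Lemma dirichlet_ge0 M mu f : distribution mu -> 0 <= dirichlet M mu f.
Proof.
case=> mu_ge0 _; apply: mulr_ge0; first by rewrite invr_ge0 ler0n.
apply: sumr_ge0 => a _; apply: sumr_ge0 => b _.
by rewrite mulr_ge0 ?sqr_ge0 // mulr_ge0 ?trans_ge0.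
Qed.

Lemma dirichletE M mu f : stationary M mu ->
  dirichlet M mu f
  = \sum_a mu a * f a ^+ 2 - \sum_a mu a * f a * \sum_b M a b * f b.
Proof.
move=> muM; have E := stationary_square f (-1) muM.
apply: etrans (etrans E _); last by field.
congr (_ * _); apply: eq_bigr => a _; apply: eq_bigr => b _.
by rewrite mulN1r.
Qed.

(** Each nonnegative term vanishes, so [f] agrees across every positive transition, and
    irreducibility joins any two states. *)
Lemma dirichlet_eq0 M mu f : irreducible M -> stationary M mu ->
  dirichlet M mu f = 0 -> forall a b, f a = f b.
Proof.
move=> irrM muM /eqP; rewrite mulf_eq0 invr_eq0 pnatr_eq0 /= => E0 a b.
have mu_gt0 := stationary_gt0 irrM muM.
have term_ge0 c d : 0 <= mu c * M c d * (f c - f d) ^+ 2.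
  by rewrite mulr_ge0 ?sqr_ge0 // mulr_ge0 ?trans_ge0 // ltW.
apply: (irreducible_closed irrM (P := fun c => f a = f c)) => // c d -> Mcd.
move: E0; rewrite psumr_eq0 => [/allP/(_ c)|c' _]; last by rewrite sumr_ge0.
rewrite mem_index_enum => /(_ isT); rewrite psumr_eq0 => [/allP/(_ d)|//].
rewrite mem_index_enum => /(_ isT) /=.
by rewrite mulf_eq0 mulf_eq0 (gt_eqF (mu_gt0 c)) (gt_eqF Mcd) sqrf_eq0 subr_eq0 => /eqP.
Qed.

(** [eigenvalue] refers to row vectors; transposing, which keeps the characteristic polynomial,
    gives a function on states. *)
Lemma eigenfunction M l : eigenvalue (trans_mx M) l ->
  exists2 f : Y -> R, exists a, f a != 0 &
    forall a, \sum_b M a b * f b = l * f a.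
Proof.
rewrite eigenvalue_root_char -char_poly_trmx -eigenvalue_root_char.
case/eigenvalueP => v vT v_neq0.
exists (fun a => v 0 (enum_rank a)).
  apply/existsP; apply: contraNT v_neq0; rewrite negb_exists => /forallP v0.
  apply/eqP/rowP => i; rewrite [RHS]mxE; apply/eqP.
  by have := v0 (enum_val i); rewrite enum_valK negbK.
move=> a; move/rowP/(_ (enum_rank a)): vT; rewrite !mxE => <-.
rewrite (big_enum_val (fun b => M a b * v 0 (enum_rank b))) /=.
by apply: eq_bigr => i _; rewrite !mxE enum_valK enum_rankK mulrC.
Qed.

(** On an eigenfunction the nonnegative sum of [stationary_square] equals [1 + c * l] times the
    squared norm, for [c = 1] and [c = -1]. *)
Lemma eigenvalue_norm_le1 M mu l : irreducible M -> stationary M mu ->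
  eigenvalue (trans_mx M) l -> - 1 <= l <= 1.
Proof.
move=> irrM muM /eigenfunction [f [a fa] Mf].
have mu_gt0 := stationary_gt0 irrM muM; have [[mu_ge0 _] _] := muM.
have norm_gt0 : 0 < \sum_a mu a * f a ^+ 2.
  rewrite (bigD1 a) //=; apply: ltr_pwDl.
    by rewrite mulr_gt0 // exprn_even_gt0 ?fa.
  by apply: sumr_ge0 => b _; rewrite mulr_ge0 ?sqr_ge0.
have crossE : \sum_a mu a * f a * (\sum_b M a b * f b)
    = l * \sum_a mu a * f a ^+ 2.
  by rewrite mulr_sumr; apply: eq_bigr => b _; rewrite Mf; ring.
have bound c : 0 <= 2^-1 * (1 + c ^+ 2) * \sum_a mu a * f a ^+ 2
    + c * (l * \sum_a mu a * f a ^+ 2).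
  rewrite -crossE -stationary_square // mulr_ge0 ?invr_ge0 ?ler0n //.
  by do 2![apply: sumr_ge0 => ? _]; rewrite mulr_ge0 ?sqr_ge0 // mulr_ge0 ?trans_ge0.
have := bound 1; have := bound (-1); set s := \sum_a _ in norm_gt0 *.
rewrite mulrA -mulrDl pmulr_lge0 // => b1; rewrite mulrA -mulrDl pmulr_lge0 // => b2.
by apply/andP; split; lra.
Qed.

Lemma mean_sub mu f c : distribution mu -> mean mu (fun a => f a - c) = mean mu f - c.
Proof.
case=> _ mu1; rewrite /mean; under eq_bigr do rewrite mulrBr.
by rewrite sumrB -mulr_suml mu1 mul1r.
Qed.

Lemma poincare M mu : irreducible M -> reversible M mu ->
  lambda2 M < 1 /\
  forall f, (1 - lambda2 M) * variance mu f <= dirichlet M mu f.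
Proof.
move=> irrM [muM revM]; have mu_gt0 := stationary_gt0 irrM muM.
have sumE F : \sum_(i < #|Y|) F (enum_val i) = \sum_a F a :> R.
  by rewrite -(big_enum_val (A := [in Y])).
have mulE (h : 'cV[R]_#|Y|) i :
    (trans_mx M *m h) i 0 = \sum_b M (enum_val i) b * h (enum_rank b) 0.
  by rewrite mxE -sumE; apply: eq_bigr => j _; rewrite mxE enum_valK.
have [|||||l_lt1 rayleigh] :=
  @second_eigenvalue_rayleigh R _ (trans_mx M) (fun i => mu (enum_val i)).
- by [].
- by move=> i j; rewrite !mxE.
- apply/colP => i; rewrite mulE mxE -[RHS](trans_sum1 M (enum_val i)).
  by apply: eq_bigr => b _; rewrite mxE mulr1.
- by move=> l /(eigenvalue_norm_le1 irrM muM) /andP[].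
(* A harmonic function has zero Dirichlet energy, hence is constant. *)
- move=> h Th i j; pose f a := h (enum_rank a) 0.
  suff /(dirichlet_eq0 irrM muM) fc : dirichlet M mu f = 0.
    by have := fc (enum_val i) (enum_val j); rewrite /f !enum_valK.
  rewrite dirichletE // -sumrB big1 // => a _.
  have := mulE h (enum_rank a); rewrite Th enum_rankK => <-.
  by rewrite /f; ring.
(* Centring [f] changes neither its variance nor its energy. *)
split=> // f; pose g a := f a - mean mu f.
have -> : variance mu f = \sum_a mu a * g a ^+ 2 by [].
have -> : dirichlet M mu f = dirichlet M mu g.
  congr (_ * _); apply: eq_bigr => a _; apply: eq_bigr => b _.
  by congr (_ * _ ^+ 2); rewrite /g; ring.
pose v : 'cV[R]_#|Y| := \col_i g (enum_val i).
have vE i : v i 0 = g (enum_val i) by rewrite mxE.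
have v_mean : \sum_i mu (enum_val i) * v i 0 = mean mu g.
  by apply: etrans (sumE (fun a => mu a * g a)); apply: eq_bigr => i _; rewrite vE.
have v_norm : \sum_i mu (enum_val i) * v i 0 ^+ 2 = \sum_a mu a * g a ^+ 2.
  by rewrite -(sumE (fun a => mu a * g a ^+ 2)); apply: eq_bigr => i _; rewrite vE.
have v_cross : \sum_i mu (enum_val i) * v i 0 * (trans_mx M *m v) i 0
    = \sum_a mu a * g a * \sum_b M a b * g b.
  rewrite -(sumE (fun a => mu a * g a * \sum_b M a b * g b)).
  apply: eq_bigr => i _; rewrite mulE vE; congr (_ * _).
  by apply: eq_bigr => b _; rewrite vE enum_rankK.
have := rayleigh v; rewrite v_mean v_norm v_cross mean_sub ?subrr; last by case: muM.
by move=> /(_ erefl); rewrite dirichletE // mulrBl mul1r lerD2l lerN2.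
Qed.

End ReversibleChain.

(** * Relaxation time as the best Poincare constant *)

Section RelaxationTime.
Variables (R : realType) (Y : finType) (M : markov_chain R Y) (mu : Y -> R).
Hypotheses (irrM : irreducible M) (revM : reversible M mu).

Lemma lambda2_default_or_eigenvalue :
  lambda2 M = 0 \/ eigenvalue (trans_mx M) (lambda2 M).
Proof.
rewrite /lambda2; have [le1|gt1] := leqP (size (eigenvalues (trans_mx M))) 1.
  by left; rewrite nth_default.
by right; apply: mem_eigenvalues; apply: mem_nth.
Qed.

Lemma relaxation_ge_half : 2^-1 <= 1 / (1 - lambda2 M).
Proof.
have [l_lt1 _] := poincare irrM revM; have [muM _] := revM.
have l_geN1 : -1 <= lambda2 M.
  have [->|/(eigenvalue_norm_le1 irrM muM)/andP[]//] := lambda2_default_or_eigenvalue.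
  by rewrite oppr_le0 ler01.
by rewrite ler_pdivlMr ?subr_gt0 //; lra.
Qed.

Lemma variance_le_relaxation p f :
  1 / (1 - lambda2 M) <= p -> variance mu f <= p * dirichlet M mu f.
Proof.
move=> lp; have [l_lt1 /(_ f) gap] := poincare irrM revM.
have [[mu_distr _] _] := revM.
apply: le_trans (ler_wpM2r (dirichlet_ge0 M f mu_distr) lp).
by rewrite mulrAC mul1r ler_pdivlMr ?subr_gt0 // mulrC.
Qed.

(** Test the inequality on an eigenfunction of [lambda2], whose energy is [1 - lambda2 M] times its
    variance. The bound [1 <= K] covers the default value [lambda2 M = 0]. *)
Lemma relaxation_le K : 1 <= K ->
  (forall f, variance mu f <= K * dirichlet M mu f) -> 1 / (1 - lambda2 M) <= K.
Proof.
move=> K_ge1 varK; have [muM _] := revM.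
have [mu_distr muP] := muM; have mu_gt0 := stationary_gt0 irrM muM.
have [->|l_eig] := lambda2_default_or_eigenvalue; first by rewrite subr0 divr1.
have [l_lt1 _] := poincare irrM revM.
have [f [a fa] Mf] := eigenfunction l_eig; set l := lambda2 M in l_lt1 Mf *.
(* Stationarity gives [mean mu f = l * mean mu f], and [l] is not 1. *)
have f_mean : mean mu f = 0.
  have meanE : mean mu f = l * mean mu f.
    rewrite mulr_sumr /mean; transitivity (\sum_a mu a * \sum_b M a b * f b).
      under [RHS]eq_bigr do rewrite mulr_sumr.
      rewrite exchange_big; apply: eq_bigr => b _.
      by rewrite -muP mulr_suml; apply: eq_bigr => c _; rewrite mulrA.
    by apply: eq_bigr => b _; rewrite Mf mulrCA.
  have /eqP : (1 - l) * mean mu f = 0 by rewrite mulrBl mul1r -meanE subrr.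
  by rewrite mulf_eq0 gt_eqF ?subr_gt0 //= => /eqP.
have norm_gt0 : 0 < \sum_a mu a * f a ^+ 2.
  rewrite (bigD1 a) //=; apply: ltr_pwDl.
    by rewrite mulr_gt0 // exprn_even_gt0 ?fa.
  by apply: sumr_ge0 => b _; rewrite mulr_ge0 ?sqr_ge0 // ltW.
have := varK f; rewrite /variance f_mean dirichletE //.
under eq_bigr do rewrite subr0.
have -> : \sum_a mu a * f a * (\sum_b M a b * f b) = l * \sum_a mu a * f a ^+ 2.
  by rewrite mulr_sumr; apply: eq_bigr => b _; rewrite Mf; ring.
rewrite -{2}[\sum_a _]mul1r -mulrBl mulrA -{1}[\sum_a _]mul1r ler_pM2r //.
by rewrite ler_pdivrMr ?subr_gt0.
Qed.

End RelaxationTime.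

(** * Decomposition of the state space *)

Section Decomposition.
Variables (R : realType) (X Y : finType) (M : markov_chain R Y) (mu : Y -> R).
Variable Yc : X -> {set Y}.
Hypotheses (irrM : irreducible M) (revM : reversible M mu).
Hypothesis Yc_partition : is_partition Yc.

Lemma sum_partition (F : Y -> R) : \sum_y F y = \sum_x \sum_(y in Yc x) F y.
Proof.
have [_ disj cover] := Yc_partition.
by rewrite -partition_disjoint_bigcup // cover; apply: eq_bigl => y; rewrite inE.
Qed.

Let mu_gt0 : forall a, 0 < mu a.
Proof. by case: revM => muM _; apply: stationary_gt0 muM. Qed.

Lemma mass_gt0 x : 0 < mass (Yc x) mu.
Proof.
have [/(_ x)/set0Pn[y yx] _ _] := Yc_partition.
by rewrite /mass (bigD1 y) //= ltr_pwDl // sumr_ge0 // => z _; apply: ltW.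
Qed.

Definition class_mean (f : Y -> R) (x : X) : R :=
  (\sum_(y in Yc x) mu y * f y) / mass (Yc x) mu.

(** Weighted by [mu] and not by the conditional distribution, so that class variances simply add
    up. *)
Definition class_variance (f : Y -> R) (x : X) : R :=
  \sum_(y in Yc x) mu y * (f y - class_mean f x) ^+ 2.

Definition class_energy (f : Y -> R) (x1 x2 : X) : R :=
  \sum_(y1 in Yc x1) \sum_(y2 in Yc x2) mu y1 * M y1 y2 * (f y1 - f y2) ^+ 2.

(** The share of [class_variance f x1] carried by moves into class [x2], the case [x2 = x1]
    included. *)
Definition exit_variance (f : Y -> R) (x1 x2 : X) : R :=
  \sum_(y1 in Yc x1) \sum_(y2 in Yc x2)
    mu y1 * M y1 y2 * (f y1 - class_mean f x1) ^+ 2.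

Lemma sum_class_mean f x :
  \sum_(y in Yc x) mu y * f y = mass (Yc x) mu * class_mean f x.
Proof. by rewrite mulrC divfK // gt_eqF ?mass_gt0. Qed.

(** Split each deviation at the class mean; the cross terms vanish because [f] minus its class mean
    sums to zero over the class. *)
Lemma law_of_total_variance f :
  variance mu f = \sum_x class_variance f x
    + variance (fun x => mass (Yc x) mu) (class_mean f).
Proof.
have meanE : mean (fun x => mass (Yc x) mu) (class_mean f) = mean mu f.
  by rewrite /mean sum_partition; apply: eq_bigr => x _; rewrite sum_class_mean.
rewrite /variance meanE; set m := mean mu f.
rewrite sum_partition -big_split; apply: eq_bigr => x _ /=.
set c := class_mean f x.
have centered : \sum_(y in Yc x) mu y * (f y - c) = 0.
  under eq_bigr do rewrite mulrBr.
  by rewrite sumrB sum_class_mean -mulr_suml subrr.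
have -> : \sum_(y in Yc x) mu y * (f y - m) ^+ 2 = class_variance f x
    + 2 * (c - m) * \sum_(y in Yc x) mu y * (f y - c) + mass (Yc x) mu * (c - m) ^+ 2.
  rewrite mulr_sumr /class_variance /mass mulr_suml -!big_split.
  by apply: eq_bigr => y _ /=; rewrite -/c; ring.
by rewrite centered mulr0 addr0.
Qed.

Lemma dirichlet_partition f :
  dirichlet M mu f = 2^-1 * \sum_x1 \sum_x2 class_energy f x1 x2.
Proof.
congr (_ * _); rewrite sum_partition; apply: eq_bigr => x1 _.
under eq_bigr do rewrite sum_partition.
by rewrite exchange_big.
Qed.

Lemma class_energy_ge0 f x1 x2 : 0 <= class_energy f x1 x2.
Proof.
do 2![apply: sumr_ge0 => ? _].
by rewrite mulr_ge0 ?sqr_ge0 // mulr_ge0 ?trans_ge0 ?ltW.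
Qed.

Lemma exit_variance_ge0 f x1 x2 : 0 <= exit_variance f x1 x2.
Proof.
do 2![apply: sumr_ge0 => ? _].
by rewrite mulr_ge0 ?sqr_ge0 // mulr_ge0 ?trans_ge0 ?ltW.
Qed.

Lemma sum_exit_variance f x1 : \sum_x2 exit_variance f x1 x2 = class_variance f x1.
Proof.
rewrite exchange_big; apply: eq_bigr => y1 _; rewrite -sum_partition.
by rewrite -mulr_suml -mulr_sumr trans_sum1 mulr1.
Qed.

(** Conditional variance and energy are the class quantities divided by the class mass, which
    cancels. *)
Lemma class_variance_le f x p (Mx := restr_chain M (Yc x)) :
    irreducible Mx -> reversible Mx (cond_distr (Yc x) mu) ->
    1 / (1 - lambda2 Mx) <= p ->
  class_variance f x <= p * (2^-1 * class_energy f x x).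
Proof.
move=> irrMx revMx lp.
have := variance_le_relaxation irrMx revMx (f \o val) lp.
have mass_neq0 : mass (Yc x) mu != 0 by rewrite gt_eqF ?mass_gt0.
have meanE : mean (cond_distr (Yc x) mu) (f \o val) = class_mean f x.
  rewrite /class_mean mulr_suml big_sub; apply: eq_bigr => y _.
  by rewrite /cond_distr /= mulrAC.
have -> : variance (cond_distr (Yc x) mu) (f \o val)
    = class_variance f x / mass (Yc x) mu.
  rewrite /variance meanE /class_variance mulr_suml [RHS]big_sub.
  by apply: eq_bigr => y _; rewrite /cond_distr /= mulrAC.
have -> : dirichlet Mx (cond_distr (Yc x) mu) (f \o val)
    = 2^-1 * class_energy f x x / mass (Yc x) mu.
  rewrite /dirichlet -mulrA; congr (_ * _); rewrite mulr_suml [RHS]big_sub.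
  apply: eq_bigr => y1 _; rewrite mulr_suml [RHS]big_sub; apply: eq_bigr => y2 _ /=.
  (* The altered loop probabilities multiply a zero difference. *)
  rewrite /cond_distr /restr_trans /=; case: (y1 =P y2) => [->|_]; last by field.
  by rewrite subrr expr0n /= !mulr0 mul0r.
by rewrite mulrA ler_pM2r // invr_gt0 mass_gt0.
Qed.

(* Split [class_mean f x1 - class_mean f x2] as the sum of [class_mean f x1 - f y1],
   [f y1 - f y2] and [f y2 - class_mean f x2], and average over the edges
   [(y1, y2)] between the two classes; the edge weight is at least [t] times
   the mass of the first class. *)
Lemma class_mean_flow_le f x1 x2 t :
    (forall y1, y1 \in Yc x1 -> t <= \sum_(y2 in Yc x2) M y1 y2) ->
  mass (Yc x1) mu * t * (class_mean f x1 - class_mean f x2) ^+ 2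
  <= 3 * (exit_variance f x1 x2 + exit_variance f x2 x1 + class_energy f x1 x2).
Proof.
move=> le_t; set D := (_ - _) ^+ 2.
have D_ge0 : 0 <= D by apply: sqr_ge0.
apply: (@le_trans _ _ (\sum_(y1 in Yc x1) \sum_(y2 in Yc x2) mu y1 * M y1 y2 * D)).
  rewrite /mass !mulr_suml; apply: ler_sum => y1 y1x.
  by rewrite -mulr_suml -mulr_sumr ler_wpM2r // ler_pM2l // le_t.
(* Reversibility puts the flow out of [x2] on the same edges as the flow out of [x1]. *)
have -> : exit_variance f x2 x1 = \sum_(y1 in Yc x1) \sum_(y2 in Yc x2)
    mu y1 * M y1 y2 * (f y2 - class_mean f x2) ^+ 2.
  rewrite exchange_big; apply: eq_bigr => y2 _; apply: eq_bigr => y1 _.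
  by case: revM => _ ->.
rewrite -!big_split mulr_sumr; apply: ler_sum => y1 _ /=.
rewrite -!big_split mulr_sumr; apply: ler_sum => y2 _ /=.
rewrite -!mulrDr [leRHS]mulrCA.
apply: ler_wpM2l; first by rewrite mulr_ge0 ?trans_ge0 // ltW.
set a := f y1; set b := f y2; set c := class_mean f x1; set d := class_mean f x2.
(* These squares are the pairwise differences of the three summands; their sum gives
   [(u + v + w)^2 <= 3 (u^2 + v^2 + w^2)]. *)
have uv := sqr_ge0 ((a - c) + (a - b)); have uw := sqr_ge0 ((a - c) + (b - d)).
have vw := sqr_ge0 ((a - b) - (b - d)); rewrite /D -/c -/d.
lra.
Qed.

Lemma variance_le_decomposition (M' : markov_chain R X) p1 p2 f
    (Mx := fun x => restr_chain M (Yc x)) (muX := fun x => mass (Yc x) mu) :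
    0 <= p1 -> (forall x, [/\ irreducible (Mx x), reversible (Mx x) (cond_distr (Yc x) mu) &
       1 / (1 - lambda2 (Mx x)) <= p1]) ->
    irreducible M' -> reversible M' muX -> 1 / (1 - lambda2 M') <= p2 ->
    (forall x1 x2, x1 != x2 -> forall y1, y1 \in Yc x1 ->
       M' x1 x2 <= \sum_(y2 in Yc x2) M y1 y2) ->
  variance mu f <= (p1 + 3 * p1 * p2 + 3 * p2) * dirichlet M mu f.
Proof.
move=> p1_ge0 hMx irrM' revM' lp2 le_flow.
rewrite law_of_total_variance.
have half_ge0 : 0 <= 2^-1 :> R by rewrite invr_ge0 ler0n.
have p2_ge0 : 0 <= p2.
  exact: le_trans half_ge0 (le_trans (relaxation_ge_half irrM' revM') lp2).
pose A := \sum_x class_energy f x x.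
pose B := \sum_x1 \sum_(x2 | x2 != x1) class_energy f x1 x2.
pose W := \sum_x class_variance f x.
have energyE : dirichlet M mu f = 2^-1 * (A + B).
  rewrite dirichlet_partition -big_split; congr (_ * _); apply: eq_bigr => x _.
  by rewrite (bigD1 x).
have A_ge0 : 0 <= A by apply: sumr_ge0 => x _; apply: class_energy_ge0.
have B_ge0 : 0 <= B by do 2![apply: sumr_ge0 => ? _]; apply: class_energy_ge0.
have W_le : W <= p1 * (2^-1 * A).
  rewrite /A !mulr_sumr; apply: ler_sum => x _.
  by have [irrMx revMx lp1] := hMx x; apply: class_variance_le.
have W_ge0 : 0 <= W.
  by do 2![apply: sumr_ge0 => ? _]; rewrite mulr_ge0 ?sqr_ge0 ?ltW.
(* [W] appears twice because each ordered pair of classes has an exit variance at either end. *)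
have varX_le : variance muX (class_mean f) <= p2 * (2^-1 * (3 * (W + W + B))).
  apply: le_trans (variance_le_relaxation irrM' revM' _ lp2) _.
  apply: ler_wpM2l => //; apply: ler_wpM2l => //.
  (* Diagonal pairs keep their exit variances, so that these sum to [W], but contribute no
     energy. *)
  have -> : W + W + B = \sum_x1 \sum_x2 (exit_variance f x1 x2 + exit_variance f x2 x1
      + (if x2 != x1 then class_energy f x1 x2 else 0)).
    under [RHS]eq_bigr do rewrite big_split big_split -big_mkcond sum_exit_variance.
    rewrite !big_split; congr (_ + _ + _); rewrite exchange_big.
    by apply: eq_bigr => x _; rewrite sum_exit_variance.
  rewrite mulr_sumr; apply: ler_sum => x1 _.
  rewrite mulr_sumr; apply: ler_sum => x2 _.
  have [->|x21] /= := eqVneq x2 x1.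
    by rewrite subrr expr0n mulr0 mulr_ge0 ?addr_ge0 ?exit_variance_ge0 ?ler0n.
  by apply: class_mean_flow_le; apply: le_flow; rewrite eq_sym.
(* The total is at most [(p1 + 3 p1 p2) A / 2 + 3 p2 B / 2]; the nonnegative products below complete
   it to a multiple of [A + B]. *)
have p2W := ler_wpM2l p2_ge0 W_le.
have p12_ge0 := mulr_ge0 p1_ge0 p2_ge0.
have p1B := mulr_ge0 p1_ge0 B_ge0; have p12B := mulr_ge0 p12_ge0 B_ge0.
have p2A := mulr_ge0 p2_ge0 A_ge0.
rewrite energyE -/W; lra.
Qed.
End Decomposition.

(** * Numerical constants and the final bound *)

Lemma inv_sqrt2_pow4_bounds (R : rcfType) : 0 < (1 - 1 / Num.sqrt 2%:R : R) ^+ 4 <= 1.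
Proof.
have sqrt2_gt1 : 1 < Num.sqrt 2%:R :> R.
  by rewrite -[ltLHS]sqrtr1 ltr_sqrt ?ltr1n ?ltr0n.
have inv_gt0 : 0 < 1 / Num.sqrt 2%:R :> R by rewrite divr_gt0 ?ltr01 // (lt_trans ltr01).
have inv_lt1 : 1 / Num.sqrt 2%:R < 1 :> R.
  by rewrite ltr_pdivrMr ?mul1r // (lt_trans ltr01).
rewrite exprn_gt0 ?subr_gt0 //= exprn_ile1 //; first by rewrite subr_ge0 ltW.
by rewrite lerBlDr lerDl ltW.
Qed.

Theorem theorem4p3 (R : realType)
    (MM : forall Y : finType, markov_chain R Y -> Prop)
    (n : forall Y : finType, markov_chain R Y -> nat)
    (pi : forall Y : finType, markov_chain R Y -> Y -> R)
    (poly1 poly2 : {poly R})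
    (MM_chain : forall (Y : finType) (M : markov_chain R Y), MM Y M ->
       [/\ irreducible M, aperiodic M & reversible M (pi Y M)])
    (MM_decomp : forall (Y : finType) (M : markov_chain R Y), MM Y M ->
       exists (X : finType) (Yc : X -> {set Y}),
       [/\ is_partition Yc,
           forall x : X,
             let Mx := restr_chain M (Yc x) in
             [/\ aperiodic Mx, irreducible Mx,
                 reversible Mx (cond_distr (Yc x) (pi Y M)) &
                 1 / (1 - lambda2 Mx) <= poly1.[(n Y M)%:R]] &
           exists M' : markov_chain R X,
             [/\ [/\ aperiodic M', irreducible M' &
                     reversible M' (fun x => mass (Yc x) (pi Y M))],
                 forall x1 x2 : X, x1 != x2 -> forall y1 : Y, y1 \in Yc x1 ->
                   \sum_(y2 in Yc x2) M y1 y2 >= M' x1 x2 &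
                 1 / (1 - lambda2 M') <= poly2.[(n Y M)%:R]]]) :
  forall (Y : finType) (M : markov_chain R Y), MM Y M ->
    1 / (1 - lambda2 M) <=
      (256%:R * poly1.[(n Y M)%:R] ^+ 2 * poly2.[(n Y M)%:R] ^+ 2)
      / (1 - 1 / Num.sqrt 2%:R) ^+ 4.
Proof.
move=> Y M MM_M; have [irrM _ revM] := MM_chain Y M MM_M.
have [X [Yc [Yc_partition hMx [M' [[_ irrM' revM'] le_flow lp2]]]]] := MM_decomp Y M MM_M.
set p1 := poly1.[_] in hMx *; set p2 := poly2.[_] in lp2 *.
have p2_ge : 2^-1 <= p2 := le_trans (relaxation_ge_half irrM' revM') lp2.
(* [X] is nonempty since the class masses sum to 1; one class suffices to bound [p1] below. *)
have [x _] : exists x : X, true.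
  apply/existsP; apply: contraT; rewrite negb_exists => /forallP X0.
  have [[[_]]] := revM'; rewrite big1 => [/eqP|x]; first by rewrite eq_sym oner_eq0.
  by have := X0 x.
have p1_ge : 2^-1 <= p1.
  have [_ irrMx revMx lp1] := hMx x.
  exact: le_trans (relaxation_ge_half irrMx revMx) lp1.
have [p1_ge0 p2_ge0] : 0 <= p1 /\ 0 <= p2 by lra.
have pp_ge : 4^-1 <= p1 * p2.
  by have := ler_pM _ _ p1_ge p2_ge; rewrite -invfM -natrM; apply; rewrite invr_ge0 ler0n.
have pp_sqr : p1 * p2 <= 4 * (p1 * p2) ^+ 2.
  have pp_ge0 : 0 <= p1 * p2 by rewrite mulr_ge0.
  by have := ler_wpM2r pp_ge0 pp_ge; rewrite expr2; lra.
have relax_le : 1 / (1 - lambda2 M) <= 64 * (p1 * p2) ^+ 2.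
  apply: (relaxation_le irrM revM) => [|f]; first by lra.
  apply: le_trans (variance_le_decomposition irrM revM Yc_partition _ p1_ge0 _ irrM' revM'
    lp2 le_flow) _.
    by move=> z; have [_ ? ? ?] := hMx z.
  apply: ler_wpM2r; first by apply: dirichlet_ge0; case: revM => -[].
  (* With [q = p1 * p2], both [p1] and [p2] are at most [2 q], so the constant is at most
     [11 q <= 44 q^2]. *)
  have := ler_wpM2r p2_ge0 p1_ge; have := ler_wpM2l p1_ge0 p2_ge; lra.
apply: le_trans relax_le _.
(* The denominator lies in [(0, 1]], so dividing by it only weakens the bound. *)
have /andP[pow_gt0 pow_le1] := inv_sqrt2_pow4_bounds R.
rewrite ler_pdivlMr // -[leRHS]mulrA -exprMn.
apply: le_trans (ler_piMr _ pow_le1) _; first by rewrite mulr_ge0 ?sqr_ge0.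
by rewrite ler_wpM2r ?sqr_ge0 // ler_nat.
Qed.
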